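(* Let $\gamma \geq 0$ be an integer. As a set-operad, the underlying set of $\mathsf{Dias}_\gamma$ is the set of all words on the alphabet $\{0\} \cup [\gamma]$ containing exactly one occurrence of $0$.
   Context: $[\gamma] = \{1, \dots, \gamma\}$. Operad means nonsymmetric operad (partial compositions $\circ_i$, unit in arity $1$). Let $\mathcal{M}_\gamma$ be the monoid $\{0\} \cup [\gamma]$ with product $\max$. The operad $\mathsf{T}\mathcal{M}_\gamma$ has as component of arity $n \geq 1$ the linear span of the words $u_1 \dots u_n$ of length $n$ on $\mathcal{M}_\gamma$, with partial compositions, for words $u$ of length $n$ and $v$ of length $m$ and $i \in [n]$, $u \circ_i v := u_1 \dots u_{i-1}\, \max(u_i, v_1) \dots \max(u_i, v_m)\, u_{i+1} \dots u_n$, and with unit the one-letter word $0$. $\mathsf{Dias}_\gamma$ is the suboperad of $\mathsf{T}\mathcal{M}_\gamma$ generated by the words $0a$ and $a0$, $a \in [\gamma]$. Since a partial composition of two words is a single word, $\mathsf{Dias}_\gamma$ is regarded as a set-operad: its underlying set is the set of words obtained from the unit $0$ and the generating words by partial compositions. *)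

(* Defs.v *)
From mathcomp Require Import all_boot all_order.

Set Implicit Arguments.
Unset Strict Implicit.
Unset Printing Implicit Defensive.

Import Order.TTheory.

(** Nonsymmetric set-operads. The graded set is encoded as one carrier with an
    arity function. Positions are numbered from 1: [pcomp x i y] stands for
    x \circ_i y and is meaningful only for 1 <= i <= arity x; nothing is
    required of it for other values of [i]. *)
Record set_operad := SetOperad {
  op_sort :> Type;
  arity : op_sort -> nat;
  op_unit : op_sort;
  pcomp : op_sort -> nat -> op_sort -> op_sort;
  arity_gt0 : forall x, 0 < arity x;
  arity_unit : arity op_unit = 1;
  arity_pcomp : forall x i y, 1 <= i <= arity x ->
    arity (pcomp x i y) = arity x + arity y - 1;
  pcomp_seq : forall x i y j z, 1 <= i <= arity x -> 1 <= j <= arity y ->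
    pcomp (pcomp x i y) (i + j - 1) z = pcomp x i (pcomp y j z);
  pcomp_par : forall x i y j z, 1 <= i -> i < j -> j <= arity x ->
    pcomp (pcomp x i y) (j + arity y - 1) z = pcomp (pcomp x j z) i y;
  unit_pcomp : forall x, pcomp op_unit 1 x = x;
  pcomp_unit : forall x i, 1 <= i <= arity x -> pcomp x i op_unit = x
}.

Definition is_suboperad (O : set_operad) (S : O -> Prop) : Prop :=
  S (op_unit O) /\
  forall x i y, S x -> S y -> 1 <= i <= arity x -> S (pcomp x i y).

Inductive generated (O : set_operad) (G : O -> Prop) : O -> Prop :=
| generated_unit : generated G (op_unit O)
| generated_gen x : G x -> generated G x
| generated_pcomp x i y : generated G x -> generated G y ->
    1 <= i <= arity x -> generated G (pcomp x i y).

Lemma generated_suboperad (O : set_operad) (G : O -> Prop) :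
  is_suboperad (generated G).
Proof. split=> [|x i y]; [exact: generated_unit | exact: generated_pcomp]. Qed.

Lemma generated_min (O : set_operad) (G S : O -> Prop) :
  is_suboperad S -> (forall x, G x -> S x) -> forall x, generated G x -> S x.
Proof.
move=> [S1 Sc] GS x; elim=> [//|y /GS //|y i z _ Sy _ Sz hi].
exact: Sc.
Qed.

(** The alphabet {0} \cup [gamma] is ['I_gamma.+1], its product is the maximum
    of the usual order, and 0 is [ord0]. *)
Definition word (gamma : nat) := {u : seq 'I_gamma.+1 | 0 < size u}.

Section Words.

Variable gamma : nat.
Implicit Types (s t r : seq 'I_gamma.+1) (u v w : word gamma).

Definition seq_pcomp s (i : nat) t :=
  take i.-1 s ++ [seq Order.max (nth ord0 s i.-1) b | b <- t] ++ drop i s.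

Lemma seq_pcomp_gt0 s i t : 0 < size t -> 0 < size (seq_pcomp s i t).
Proof. by move=> t0; rewrite !size_cat size_map addnCA ltn_addr. Qed.

Definition word_unit : word gamma := exist _ [:: ord0] isT.

Definition word_pcomp u (i : nat) v : word gamma :=
  exist _ (seq_pcomp (val u) i (val v)) (seq_pcomp_gt0 _ i (valP v)).

Lemma seq_pcompE s x t r :
  seq_pcomp (s ++ x :: t) (size s).+1 r = s ++ [seq Order.max x b | b <- r] ++ t.
Proof.
rewrite /seq_pcomp /= take_size_cat // nth_cat ltnn subnn /=.
by rewrite -cat_rcons drop_size_cat // size_rcons.
Qed.

Lemma splitN s i : 1 <= i <= size s ->
  exists a x b, s = a ++ x :: b /\ i = (size a).+1.
Proof.
case: i => // i /= hi; exists (take i s), (nth ord0 s i), (drop i.+1 s).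
by rewrite -drop_nth // cat_take_drop size_takel // ltnW.
Qed.

Lemma word_arity_pcomp u i v : 1 <= i <= size (val u) ->
  size (val (word_pcomp u i v)) = size (val u) + size (val v) - 1.
Proof.
case: u v => [s /= s0] [t /= t0] /splitN [a [x [b [-> ->]]]].
rewrite seq_pcompE !size_cat size_map /= addnS addSn subn1 /=.
by rewrite -addnA (addnC (size t)).
Qed.

Lemma word_pcomp_seq u i v j w :
  1 <= i <= size (val u) -> 1 <= j <= size (val v) ->
  word_pcomp (word_pcomp u i v) (i + j - 1) w =
  word_pcomp u i (word_pcomp v j w).
Proof.
case: u v w => [s /= s0] [t /= t0] [r /= r0] hi hj; apply: val_inj => /=.
case: (splitN hi) => a [x [b [-> ->]]]; case: (splitN hj) => c [y [d [-> ->]]].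
rewrite !seq_pcompE !map_cat /= -!catA cat_cons catA.
have -> : (size a).+1 + (size c).+1 - 1 =
    (size (a ++ [seq Order.max x b0 | b0 <- c])).+1.
  by rewrite size_cat size_map addSn addnS subn1.
rewrite seq_pcompE -!catA -map_comp; congr (_ ++ (_ ++ (_ ++ _))).
by apply: eq_map => z /=; rewrite maxA.
Qed.

Lemma word_pcomp_par u i v j w :
  1 <= i -> i < j -> j <= size (val u) ->
  word_pcomp (word_pcomp u i v) (j + size (val v) - 1) w =
  word_pcomp (word_pcomp u j w) i v.
Proof.
case: u v w => [s /= s0] [t /= t0] [r /= r0] i1 ij js; apply: val_inj => /=.
have hi : 1 <= i <= size s by rewrite i1 (leq_trans (ltnW ij)).
case: (splitN hi) ij js => a [x [b [-> ->]]] ij js.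
have hj : 1 <= j - (size a).+1 <= size b.
  by rewrite subn_gt0 ij leq_subLR; move: js; rewrite size_cat /= addnS addSn.
case: (splitN hj) => c [y [d [-> jE]]].
have -> : j = (size (a ++ x :: c)).+1.
  by rewrite -(subnKC (ltnW ij)) jE size_cat /= !addnS !addSn.
rewrite seq_pcompE.
have -> : a ++ [seq Order.max x b0 | b0 <- t] ++ c ++ y :: d =
   (a ++ [seq Order.max x b0 | b0 <- t] ++ c) ++ y :: d by rewrite -!catA.
have -> : (size (a ++ x :: c)).+1 + size t - 1 =
   (size (a ++ [seq Order.max x b0 | b0 <- t] ++ c)).+1.
  rewrite !size_cat size_map /= addSn subn1 /= addnS addSn.
  by rewrite -addnA (addnC (size c)).
rewrite seq_pcompE.
have -> : a ++ x :: c ++ y :: d = (a ++ x :: c) ++ y :: d by rewrite -catA.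
by rewrite seq_pcompE -!catA cat_cons seq_pcompE.
Qed.

Lemma word_unit_pcomp u : word_pcomp word_unit 1 u = u.
Proof.
case: u => [s s0]; apply: val_inj => /=; rewrite /seq_pcomp /= cats0.
by rewrite -[RHS]map_id; apply: eq_map => z; apply/max_idPr/leq0n.
Qed.

Lemma word_pcomp_unit u i : 1 <= i <= size (val u) ->
  word_pcomp u i word_unit = u.
Proof.
case: u => [s /= s0] hi; apply: val_inj => /=.
case: (splitN hi) => a [x [b [-> ->]]]; rewrite seq_pcompE /=.
by congr (_ ++ _ :: _); apply/max_idPl/leq0n.
Qed.

End Words.

Definition TM (gamma : nat) : set_operad :=
  @SetOperad (word gamma) (fun u => size (val u)) (word_unit gamma)
    (@word_pcomp gamma) (fun u => valP u) (erefl 1) (@word_arity_pcomp gamma)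
    (@word_pcomp_seq gamma) (@word_pcomp_par gamma) (@word_unit_pcomp gamma)
    (@word_pcomp_unit gamma).

(** [a] ranges over {1, ..., gamma}, i.e. over the nonzero letters. *)
Definition dias_gen (gamma : nat) (u : TM gamma) : Prop :=
  exists2 a : 'I_gamma.+1, a != ord0 &
    val u = [:: ord0; a] \/ val u = [:: a; ord0].

Definition Dias (gamma : nat) : TM gamma -> Prop :=
  generated (@dias_gen gamma).
Arguments Dias gamma u : clear implicits.

(* Main.v *)
(** One occurrence of 0 is preserved by partial composition: substituting [v] at a
    letter [x] of [u] copies [v] when [x] is 0 and erases its zeros otherwise.
    Conversely 0c \circ_1 u = uc and c0 \circ_2 u = cu, so every word
    a_1 ... a_k 0 b_1 ... b_l is reached from the unit 0 by adding the nonzero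
    letters one at a time at either end. *)
Require Import Defs.
From mathcomp Require Import all_boot all_order.

Set Implicit Arguments.
Unset Strict Implicit.
Unset Printing Implicit Defensive.

Import Order.TTheory.

Section Dias.

Variable gamma : nat.
Implicit Types (x y c : 'I_gamma.+1) (s t : seq 'I_gamma.+1).

Lemma max_ord0l : left_id ord0 (@Order.max _ 'I_gamma.+1).
Proof. by move=> x; apply/max_idPr/leq0n. Qed.

(** Since [ord0] is the least letter, equality with it amounts to being bounded above by it, and a
    maximum is bounded iff both arguments are. *)
Lemma max_eq_ord0 x y : (Order.max x y == ord0) = (x == ord0) && (y == ord0).
Proof.
have le0 z : (z <= ord0)%O = (z == ord0) by rewrite -val_eqE /= -leqn0.
by rewrite -!le0 ge_max.
Qed.

Lemma count_ord0_map_max x t :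
  count_mem ord0 [seq Order.max x y | y <- t] = (x == ord0) * count_mem ord0 t.
Proof.
elim: t => [|y t IHt] /=; first by rewrite muln0.
by rewrite IHt max_eq_ord0 mulnDr mulnb.
Qed.

Lemma Dias_count_ord0 (u : word gamma) :
  Dias gamma u -> count_mem ord0 (val u) = 1.
Proof.
apply: (@generated_min (TM gamma) _ (fun v => count_mem ord0 (val v) = 1)).
  split=> //= v i w v1 w1 /splitN [s [x [t [vE ->]]]].
  (* By [w1] the inserted block has [(x == ord0) * 1] zeros, exactly what the letter [x] contributed
     to [v]. *)
  by move: v1; rewrite vE seq_pcompE !count_cat count_ord0_map_max w1 muln1.
by move=> v [c /negbTE c0 [->|->]] /=; rewrite c0.
Qed.

(** The longer word is given through an equation on [val], so that no particular proof of
    nonemptiness is fixed. *)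
Lemma Dias_rcons (u v : word gamma) c : c != ord0 -> Dias gamma u ->
  val v = rcons (val u) c -> Dias gamma v.
Proof.
move=> c0 Du vE; pose g : word gamma := exist _ [:: ord0; c] isT.
have -> : v = word_pcomp g 1 u.
  apply: val_inj; rewrite /= vE /seq_pcomp /= (eq_map max_ord0l) map_id.
  by rewrite cats1.
by apply: (@generated_pcomp (TM gamma)) => //; apply: generated_gen; exists c; [|left].
Qed.

Lemma Dias_cons (u v : word gamma) c : c != ord0 -> Dias gamma u ->
  val v = c :: val u -> Dias gamma v.
Proof.
move=> c0 Du vE; pose g : word gamma := exist _ [:: c; ord0] isT.
have -> : v = word_pcomp g 2 u.
  by apply: val_inj; rewrite /= vE /seq_pcomp /= (eq_map max_ord0l) map_id cats0.
by apply: (@generated_pcomp (TM gamma)) => //; apply: generated_gen; exists c; [|right].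
Qed.

(** Induction on [s] strips letters from the left end; once [s] is empty, induction on [t] strips
    them from the right end, down to the unit. *)
Lemma Dias_cat_ord0 s t (u : word gamma) :
  ord0 \notin s -> ord0 \notin t -> val u = s ++ ord0 :: t -> Dias gamma u.
Proof.
elim: s u => [|c s IHs] u.
  move=> _; elim/last_ind: t u => [|t c IHt] u.
    by move=> _ uE; rewrite (_ : u = word_unit gamma);
      [exact: generated_unit | exact: val_inj].
  rewrite mem_rcons inE negb_or eq_sym => /andP [c0 t0] uE.
  pose v : word gamma := exist _ (ord0 :: t) isT.
  exact: (@Dias_rcons v _ _ c0 (IHt v t0 erefl) uE).
rewrite inE negb_or eq_sym => /andP [c0 s0] t0 uE.
have st_gt0 : 0 < size (s ++ ord0 :: t) by rewrite size_cat addnS.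
pose v : word gamma := exist _ (s ++ ord0 :: t) st_gt0.
exact: (@Dias_cons v _ _ c0 (IHs v s0 t0 erefl) uE).
Qed.

End Dias.

Theorem proposition2p1p1 (gamma : nat) (u : word gamma) :
  Dias gamma u <-> count_mem (ord0 : 'I_gamma.+1) (val u) = 1.
Proof.
split=> [|u1]; first exact: Dias_count_ord0.
have : ord0 \in val u by rewrite -has_pred1 has_count u1.
case/splitPr uE: _ / => [s t]; move: u1; rewrite uE count_cat /= add1n addnS.
(* The zero at the split already accounts for the whole count, so [s] and [t] contain none. *)
case=> /eqP; rewrite addn_eq0 => /andP [/eqP s0 /eqP t0].
by apply: (Dias_cat_ord0 _ _ uE); apply/count_memPn.
Qed.
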